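(* Let $K \subsetneq L$ be a field extension, and let $A$ and $B$ be two $n$-dimensional $K$-subspaces of $L$, with $n > 0$ and $1 \notin B$. Then $A$ is matched to $B$ if and only if for every pair of nonzero $K$-subspaces $S \subseteq A$ and $R \subseteq B \oplus K$ with $\langle SR \rangle = S$, we have $\dim S \leq \dim\big(B/(R \cap B)\big)$.
   Context: All dimensions are over $K$. For $K$-subspaces $S, R$ of $L$, $SR = \{sr : s \in S, r \in R\}$ and $\langle SR \rangle$ denotes the $K$-subspace of $L$ spanned by $SR$. $B \oplus K$ denotes the $K$-subspace $B + K$ of $L$ (a direct sum since $1 \notin B$). For $x \in L^\times$ and a subspace $A$, $x^{-1}A = \{x^{-1}a : a \in A\}$. An ordered basis $\{a_1, \ldots, a_n\}$ of $A$ is matched to an ordered basis $\{b_1, \ldots, b_n\}$ of $B$ if $a_i^{-1}A \cap B \subseteq \langle b_1, \ldots, b_{i-1}, b_{i+1}, \ldots, b_n\rangle$ for each $i \in \{1, \ldots, n\}$. $A$ is matched to $B$ if every ordered basis of $A$ can be matched to some ordered basis of $B$. *)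

(* Defs.v *)
From HB Require Import structures.
From mathcomp Require Import all_boot all_algebra.
From mathcomp Require Import generic_quotient ring_quotient.
From mathcomp Require Import boolp classical_sets.

Set Implicit Arguments.
Unset Strict Implicit.
Unset Printing Implicit Defensive.

Import GRing.Theory.

Local Open Scope ring_scope.
Local Open Scope classical_set_scope.
Local Open Scope quotient_scope.

(* A field extension L / K of arbitrary (possibly infinite) degree: a field L
   that is a K-algebra, K being embedded in L by a |-> a%:A. The library
   structure fieldExtType covers finite extensions only. *)
#[short(type="fieldAlgType")]
HB.structure Definition FieldAlgebra (K : fieldType) :=
  {L of GRing.Algebra K L & GRing.Field L}.

Section LinearAlgebra.
Variables (K : fieldType) (V : lmodType K).
Implicit Types S U X : set V.

Definition subspace S : Prop := submod_closed [in S].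

Definition lspan X : set V := smallest subspace X.

Definition lin_indep n (b : 'I_n -> V) : Prop :=
  forall c : 'I_n -> K, \sum_i c i *: b i = 0 -> forall i, c i = 0.

Definition is_basis S n (b : 'I_n -> V) : Prop :=
  lin_indep b /\ lspan (range b) = S.

Definition has_dim S n : Prop := exists b : 'I_n -> V, is_basis S b.

(* The value is 0 by convention when S has no finite basis. *)
Definition sdim S : nat := xget 0%N (has_dim S).

Lemma subspace_lspan X : subspace (lspan X).
Proof.
split; first by apply/mem_set => S [[S0 _] _]; exact: set_mem.
move=> a u v /set_mem Xu /set_mem Xv; apply/mem_set => S [subS XS].
apply/set_mem; apply: subS.2; apply/mem_set; [exact: Xu|exact: Xv].
Qed.

End LinearAlgebra.

(* The quotient space V / lspan U, so V / U when U is a subspace. Taking the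
   span makes the construction total in the set U. *)
Section QuotientSpace.
Variables (K : fieldType) (V : lmodType K) (U : set V).

Definition lspan_pred : V -> bool := [in lspan U].

HB.instance Definition _ :=
  GRing.isZmodClosed.Build V lspan_pred
    (GRing.submod_closedB (subspace_lspan U)).

Definition quot_space : Type :=
  Quotient.quot (GRing.ZmodClosed.clone V lspan_pred _).

HB.instance Definition _ := GRing.Zmodule.on quot_space.

Definition quot_map : V -> quot_space := \pi_quot_space.

Lemma quot_mapD : {morph quot_map : u v / u + v}.
Proof. exact: raddfD. Qed.

Lemma quot_map_repr (x : quot_space) : quot_map (repr x) = x.
Proof. exact: reprK. Qed.

Lemma quot_map_eq u v : quot_map u = quot_map v <-> lspan U (u - v).
Proof.
rewrite /quot_map; split=> [/eqP|Uuv].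
  by rewrite -Quotient.idealrBE => /set_mem.
by apply/eqP; rewrite -Quotient.idealrBE; exact: mem_set.
Qed.

Definition quot_scale (a : K) (x : quot_space) : quot_space :=
  quot_map (a *: repr x).

Lemma quot_mapZ a u : quot_map (a *: u) = quot_scale a (quot_map u).
Proof.
apply/quot_map_eq; rewrite -scalerBr -[_ *: _]addr0.
have [S0 Slin] := subspace_lspan U.
apply/set_mem/Slin => //; apply/mem_set/quot_map_eq.
by rewrite quot_map_repr.
Qed.

Fact quot_scaleA a b x : quot_scale a (quot_scale b x) = quot_scale (a * b) x.
Proof. by rewrite -[x]quot_map_repr -!quot_mapZ scalerA. Qed.

Fact quot_scale1 : left_id 1 quot_scale.
Proof. by move=> x; rewrite -[x]quot_map_repr -quot_mapZ scale1r. Qed.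

Fact quot_scaleDr : right_distributive quot_scale +%R.
Proof.
move=> a x y; rewrite -[x]quot_map_repr -[y]quot_map_repr.
by rewrite -quot_mapD -!quot_mapZ scalerDr quot_mapD.
Qed.

Fact quot_scaleDl x : {morph quot_scale^~ x : a b / a + b}.
Proof.
by move=> a b; rewrite -[x]quot_map_repr -!quot_mapZ scalerDl quot_mapD.
Qed.

HB.instance Definition _ := GRing.Zmodule_isLmodule.Build K quot_space
  quot_scaleA quot_scale1 quot_scaleDr quot_scaleDl.

End QuotientSpace.

(* The dimension of S / U, the image of S in V / U. *)
Definition quot_dim (K : fieldType) (V : lmodType K) (S U : set V) : nat :=
  sdim (quot_map U @` S).

Section Matching.
Variables (K : fieldType) (L : fieldAlgType K).
Implicit Types A B S R : set L.

Definition scalars : set L := range (fun a : K => a%:A).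

Definition mul_set S R : set L := [set s * r | s in S & r in R].

Definition add_scalars B : set L := [set b + c | b in B & c in scalars].

Definition basis_matched A B n (a b : 'I_n -> L) : Prop :=
  forall i, [set (a i)^-1 * x | x in A] `&` B `<=` lspan (b @` [set j | j <> i]).

Definition matched A B : Prop :=
  forall n (a : 'I_n -> L), is_basis A a ->
    exists2 b : 'I_n -> L, is_basis B b & basis_matched A B a b.

End Matching.

Arguments scalars K L : clear implicits.

(* Main.v *)
(* Necessity: if [a] is a basis of A whose first s = dim S vectors span S, then
   R and B meet inside every a_i^-1 A with i < s, so the first s coordinates on
   the matched basis of B vanish there and dim (R /\ B) <= n - s.

   Sufficiency: the bases of B matched to [a] are the dual bases of independent
   transversals of the annihilators of the spaces a_i^-1 A /\ B. By the linear
   form of Rado's theorem such a transversal exists unless some S spanned by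
   part of [a] and some T inside B satisfy S T <= A and dim S + dim T > n. Then
   the Dyson-type transforms (S, R) |-> (S + x R, R /\ x^-1 S) with x in S,
   started at (S, T + K), keep S R inside A, 1 in R and dim S + dim R, and
   enlarge S as long as S R is not inside S; the final pair violates the dimension
   condition. *)
Require Import Defs.
From mathcomp Require Import all_boot all_algebra.
From mathcomp Require Import boolp classical_sets zify.

Set Implicit Arguments.
Unset Strict Implicit.
Unset Printing Implicit Defensive.

Import GRing.Theory.

Local Open Scope ring_scope.
Local Open Scope classical_set_scope.

(** * Subspaces in coordinates: row spaces of matrices, bases and dimension *)

Section Coordinates.
Variables (K : fieldType) (V : lmodType K).
Implicit Types (S T : set V) (m n : nat).

Lemma subspaceP S :
  subspace S <-> S 0 /\ forall a u v, S u -> S v -> S (a *: u + v).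
Proof.
split=> [[/set_mem S0 Slin]|[S0 Slin]].
  by split=> // a u v Su Sv; apply/set_mem/Slin; apply/mem_set.
by split; [exact/mem_set|move=> a u v /set_mem Su /set_mem Sv; exact/mem_set/Slin].
Qed.

Lemma subspaceD S u v : subspace S -> S u -> S v -> S (u + v).
Proof. by move=> /subspaceP [_ Slin] Su Sv; rewrite -[u]scale1r; exact: Slin. Qed.

Lemma subspaceZ S a u : subspace S -> S u -> S (a *: u).
Proof. by move=> /subspaceP [S0 Slin] Su; rewrite -[_ *: _]addr0; exact: Slin. Qed.

Lemma subspace_sum S (I : finType) (F : I -> V) :
  subspace S -> (forall i, S (F i)) -> S (\sum_i F i).
Proof.
move=> subS SF; apply: (big_ind S) => //; first by case/subspaceP: subS.
by move=> u v; exact: subspaceD.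
Qed.

Lemma sub_lspan (X : set V) : X `<=` lspan X.
Proof. exact: sub_gen_smallest. Qed.

Lemma lspan_sub (X S : set V) : subspace S -> X `<=` S -> lspan X `<=` S.
Proof. by move=> subS XS; exact: smallest_sub. Qed.

Lemma lspan_id S : subspace S -> lspan S = S.
Proof. by move=> subS; apply/seteqP; split; [exact: lspan_sub|exact: sub_lspan]. Qed.

(** Coordinates are row vectors, so that passing from one family to another is a matrix product and
    rank theory for matrices becomes available. *)
Definition lcomb n (c : 'I_n -> V) (v : 'rV[K]_n) : V := \sum_i v 0 i *: c i.

Lemma lcomb0 n (c : 'I_n -> V) : lcomb c 0 = 0.
Proof. by rewrite /lcomb big1 // => i _; rewrite mxE scale0r. Qed.

Lemma lcombP n (c : 'I_n -> V) a u v :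
  lcomb c (a *: u + v) = a *: lcomb c u + lcomb c v.
Proof.
rewrite /lcomb scaler_sumr -big_split; apply: eq_bigr => i _ /=.
by rewrite !mxE scalerDl scalerA.
Qed.

Lemma lcombD n (c : 'I_n -> V) u v : lcomb c (u + v) = lcomb c u + lcomb c v.
Proof. by rewrite -[u]scale1r lcombP !scale1r. Qed.

Lemma lcomb_delta n (c : 'I_n -> V) i : lcomb c (delta_mx 0 i) = c i.
Proof.
rewrite /lcomb (bigD1 i) //= big1 => [|j /negPf ji].
  by rewrite mxE !eqxx scale1r addr0.
by rewrite mxE ji andbF scale0r.
Qed.

Lemma lcomb_mul m n (c : 'I_n -> V) (M : 'M_(m, n)) v :
  lcomb c (v *m M) = lcomb (fun i => lcomb c (row i M)) v.
Proof.
rewrite /lcomb; under [RHS]eq_bigr do rewrite scaler_sumr.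
rewrite exchange_big; apply: eq_bigr => j _ /=; rewrite mxE scaler_suml.
by apply: eq_bigr => i _; rewrite scalerA mxE.
Qed.

Lemma lcomb_map (W : lmodType K) (f : V -> W) n (c : 'I_n -> V) v :
  {morph f : x y / x + y} -> (forall a x, f (a *: x) = a *: f x) ->
  f (lcomb c v) = \sum_i v 0 i *: f (c i).
Proof.
move=> fD fZ; rewrite /lcomb; have f0 : f 0 = 0 by rewrite -(scale0r 0) fZ scale0r.
by rewrite (big_morph f fD f0); under eq_bigr do rewrite fZ.
Qed.

Lemma lin_indepP n (c : 'I_n -> V) :
  lin_indep c <-> forall v, lcomb c v = 0 -> v = 0.
Proof.
split=> [fc v cv0|fc k kc0 i].
  by apply/rowP => i; rewrite mxE (fc (v 0)).
have /fc /rowP/(_ i) : lcomb c (\row_i k i) = 0; last by rewrite !mxE.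
by rewrite -[RHS]kc0; apply: eq_bigr => j _; rewrite mxE.
Qed.

Lemma lin_indep_neq0 n (c : 'I_n -> V) i : lin_indep c -> c i != 0.
Proof.
move=> /lin_indepP fc; apply/eqP; rewrite -lcomb_delta => /fc /rowP/(_ i)/eqP.
by rewrite !mxE !eqxx oner_eq0.
Qed.

Lemma lcomb_inj n (c : 'I_n -> V) : lin_indep c -> injective (lcomb c).
Proof.
move=> /lin_indepP fc u v uv; apply/eqP; rewrite -subr_eq0; apply/eqP/fc.
by rewrite addrC -scaleN1r lcombP uv scaleN1r addNr.
Qed.

Lemma subspace_lcomb S n (c : 'I_n -> V) v :
  subspace S -> (forall i, S (c i)) -> S (lcomb c v).
Proof. by move=> subS Sc; apply: subspace_sum => // i; exact: subspaceZ. Qed.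

Lemma lspan_range n (c : 'I_n -> V) : lspan (range c) = range (lcomb c).
Proof.
apply/seteqP; split.
  apply: lspan_sub => [|_ [i _ <-]]; last by exists (delta_mx 0 i); rewrite ?lcomb_delta.
  apply/subspaceP; split; first by exists 0; rewrite ?lcomb0.
  by move=> a _ _ [u _ <-] [v _ <-]; exists (a *: u + v); rewrite ?lcombP.
move=> _ [v _ <-]; apply: subspace_lcomb => [|i]; first exact: subspace_lspan.
by apply: sub_lspan; exists i.
Qed.

Definition coord_space m n (c : 'I_n -> V) (M : 'M[K]_(m, n)) : set V :=
  [set lcomb c v | v in [set v : 'rV[K]_n | (v <= M)%MS]].

Lemma coord_spaceE m n c (M : 'M[K]_(m, n)) v :
  lin_indep c -> coord_space c M (lcomb c v) <-> (v <= M)%MS.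
Proof.
by move=> fc; split=> [[u uM /(lcomb_inj fc) <-]//|vM]; exists v.
Qed.

Lemma has_dim_coord m n (c : 'I_n -> V) (M : 'M_(m, n)) :
  lin_indep c -> has_dim (coord_space c M) (\rank M).
Proof.
move=> fc; exists (fun i => lcomb c (row i (row_base M))); split.
  apply/lin_indepP => v; rewrite -lcomb_mul => /(proj1 (lin_indepP _) fc).
  by rewrite -(mul0mx _ (row_base M)); apply: row_free_inj; exact: row_base_free.
rewrite lspan_range; apply/seteqP; split=> x [v].
  move=> _ <-; exists (v *m row_base M); last by rewrite lcomb_mul.
  by rewrite /= -(eq_row_base M) submxMl.
rewrite /= -(eq_row_base M) => /submxP [w ->] <-; exists w => //.
by rewrite lcomb_mul.
Qed.

(** Among the matrices whose coordinate space lies in [S], take one of maximal rank. Adjoining the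
    coordinates of any element of [S] stays inside [S], so by maximality they already lie in its row
    space. *)
Lemma subspace_coord_mx S n (c : 'I_n -> V) :
  subspace S -> S `<=` range (lcomb c) ->
  exists M : 'M_n, S = coord_space c M.
Proof.
move=> subS Sc.
pose P r := `[< exists M : 'M[K]_n, \rank M = r /\ coord_space c M `<=` S >].
have exP : exists r, P r.
  exists 0%N; apply/asboolP; exists 0; split; first by rewrite mxrank0.
  by move=> x [v /=]; rewrite submx0 => /eqP -> <-; rewrite lcomb0; case/subspaceP: subS.
have ubP r : P r -> (r <= n)%N by move=> /asboolP [M [<- _]]; exact: rank_leq_row.
case: (ex_maxnP exP ubP) => r /asboolP [M [rM MS]] maxr.
exists M; apply/seteqP; split=> // x Sx; have [v _ vx] := Sc x Sx.
exists v => //=; have : P (\rank (M + v)%MS).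
  apply/asboolP; exists (M + v)%MS; split=> // y [w /sub_addsmxP [[w1 w2] -> <-]].
  rewrite lcombD; apply: subspaceD => //.
    by apply: MS; exists (w1 *m M); rewrite //= submxMl.
  rewrite [w2]mx11_scalar mul_scalar_mx -[_ *: v]addr0 lcombP lcomb0 addr0 vx.
  exact: subspaceZ.
move=> /maxr; rewrite -rM (geq_leqif (mxrank_leqif_sup (addsmxSl M v))).
by rewrite addsmx_sub => /andP [].
Qed.

(** A relation between the rows of coordinates of [b] in terms of [c] would be a relation in [b];
    hence these rows form a row-free matrix with [n] columns. *)
Lemma lin_indep_leq m n (b : 'I_m -> V) (c : 'I_n -> V) :
  lin_indep b -> (forall i, range (lcomb c) (b i)) -> (m <= n)%N.
Proof.
move=> fb bc.
have /choice [w wE] : forall i, exists w, lcomb c w = b i.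
  by move=> i; have [w] := bc i; exists w.
suff /eqP <- : row_free (\matrix_i w i) by exact: rank_leq_col.
rewrite -kermx_eq0; apply/eqP/row_matrixP => i; rewrite row0.
apply: (proj1 (lin_indepP _) fb).
transitivity (lcomb c (row i (kermx (\matrix_i w i)) *m \matrix_i w i)).
  by rewrite lcomb_mul; apply: eq_bigr => j _; rewrite rowK wE.
by rewrite -row_mul mulmx_ker row0 lcomb0.
Qed.

Lemma has_dim_leq S T m n :
  S `<=` T -> has_dim S m -> has_dim T n -> (m <= n)%N.
Proof.
move=> ST [b [fb bS]] [c [fc cT]]; apply: (@lin_indep_leq _ _ b c) => // i.
rewrite -lspan_range cT; apply: ST; rewrite -bS; apply: sub_lspan; by exists i.
Qed.

Lemma has_dim_inj S m n : has_dim S m -> has_dim S n -> m = n.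
Proof.
by move=> dm dn; apply/eqP; rewrite eqn_leq !(@has_dim_leq S S).
Qed.

Lemma sdimE S n : has_dim S n -> sdim S = n.
Proof.
move=> dS; rewrite /sdim; case: xgetP => [m _ dm|/(_ n)//].
exact: has_dim_inj dm dS.
Qed.

Lemma subspace_has_dim S T n : subspace S -> S `<=` T -> has_dim T n ->
  exists2 m, (m <= n)%N & has_dim S m.
Proof.
move=> subS ST [c [fc cT]].
have [|M ->] := @subspace_coord_mx S _ c subS; first by rewrite -lspan_range cT.
by exists (\rank M); [exact: rank_leq_row|exact: has_dim_coord].
Qed.

Definition sumset S T : set V := [set x + y | x in S & y in T].

Lemma subspaceI S T : subspace S -> subspace T -> subspace (S `&` T).
Proof.
move=> /subspaceP [S0 Sl] /subspaceP [T0 Tl]; apply/subspaceP; split=> //.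
by move=> a u v [Su Tu] [Sv Tv]; split; [exact: Sl|exact: Tl].
Qed.

(** Inside [U] both subspaces become row spaces, and the rank formula for sums and intersections of
    row spaces carries over. *)
Lemma has_dim_sum_cap U S T n s t :
  has_dim U n -> subspace S -> subspace T -> S `<=` U -> T `<=` U ->
  has_dim S s -> has_dim T t ->
  exists p q, [/\ has_dim (sumset S T) p, has_dim (S `&` T) q & (p + q = s + t)%N].
Proof.
move=> [c [fc cU]] subS subT; rewrite -cU lspan_range => SU TU dS dT.
have [M SM] := @subspace_coord_mx _ _ c subS SU.
have [N TN] := @subspace_coord_mx _ _ c subT TU.
have eS : \rank M = s by apply: has_dim_inj dS; rewrite SM; exact: has_dim_coord.
have eT : \rank N = t by apply: has_dim_inj dT; rewrite TN; exact: has_dim_coord.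
exists (\rank (M + N)%MS), (\rank (M :&: N)%MS); split.
- suff -> : sumset S T = coord_space c (M + N)%MS by exact: has_dim_coord.
  rewrite SM TN; apply/seteqP; split.
    move=> _ [_ [u uM <-] [_ [v vN <-] <-]]; exists (u + v); last by rewrite lcombD.
    by rewrite /= addmx_sub_adds.
  move=> x [w /sub_addsmxP [[u v] ->] <-]; rewrite lcombD.
  exists (lcomb c (u *m M)); first by exists (u *m M); rewrite //= submxMl.
  by exists (lcomb c (v *m N)) => //; exists (v *m N); rewrite //= submxMl.
- suff -> : S `&` T = coord_space c (M :&: N)%MS by exact: has_dim_coord.
  rewrite SM TN; apply/seteqP; split.
    move=> _ [[u uM <-] /(coord_spaceE _ _ fc) uN]; exists u => //=.
    by rewrite sub_capmx uM.
  move=> _ [u /= uMN <-]; move: uMN; rewrite sub_capmx => /andP [uM uN].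
  by split; exists u.
- by rewrite mxrank_sum_cap eS eT.
Qed.

Lemma has_dim_subspace S n : has_dim S n -> subspace S.
Proof. by move=> [c [_ <-]]; exact: subspace_lspan. Qed.

Lemma has_dim_set0 : has_dim [set (0 : V)] 0.
Proof.
exists (fun=> 0); split=> [k _ []//|]; rewrite lspan_range; apply/seteqP; split.
  by move=> _ [v _ <-]; rewrite /lcomb big_ord0.
by move=> _ ->; exists 0; rewrite ?lcomb0.
Qed.

(** Serves both to adjoin the scalars to a subspace without 1 and to show that a proper inclusion
    raises the dimension. *)
Lemma has_dim_sum_line S n (v : V) : has_dim S n -> ~ S v ->
  has_dim (sumset S (range (fun a : K => a *: v))) n.+1.
Proof.
move=> dS Sv; have subS := has_dim_subspace dS; have [b [fb bS]] := dS.
pose c i := oapp b v (unlift ord0 i).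
have cE (k : 'I_n.+1 -> K) : \sum_i k i *: c i =
    \sum_i k (lift ord0 i) *: b i + k ord0 *: v.
  rewrite big_ord_recl addrC /c unlift_none; congr (_ + _).
  by apply: eq_bigr => i _; rewrite liftK.
have Sb (k : 'I_n -> K) : S (\sum_i k i *: b i).
  apply: subspace_sum => // i; apply: subspaceZ => //.
  by rewrite -bS; apply: sub_lspan; exists i.
exists c; split.
  move=> k; rewrite cE => k0.
  have kv : k ord0 = 0.
    apply/eqP; apply: contrapT => /negP nz; apply: Sv.
    have -> : v = (- (k ord0)^-1) *: \sum_i k (lift ord0 i) *: b i.
      apply/eqP; rewrite scaleNr -addr_eq0 -[X in X + _]scale1r.
      by rewrite -(mulVf nz) -scalerA -scalerDr addrC k0 scaler0.
    exact: subspaceZ.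
  move: k0; rewrite kv scale0r addr0 => k0 i.
  by case: (unliftP ord0 i) => [j|] ->; [exact: (fb _ k0)|].
rewrite lspan_range; apply/seteqP; split.
  move=> _ [u _ <-]; rewrite /lcomb cE; exists (\sum_i u 0 (lift ord0 i) *: b i).
    exact: (Sb (fun i => u 0 (lift ord0 i))).
  by exists (u 0 ord0 *: v) => //; exists (u 0 ord0).
move=> _ [x Sx [_ [a _ <-] <-]]; move: Sx; rewrite -bS lspan_range => -[u _ <-].
exists (\row_i oapp (u 0) a (unlift ord0 i)) => //.
rewrite /lcomb cE mxE unlift_none; congr (_ + _).
by apply: eq_bigr => i _; rewrite mxE liftK.
Qed.

End Coordinates.

(** * Rank-nullity and the dimension of quotients *)

Lemma has_dim_image (K : fieldType) (V W : lmodType K) (f : V -> W)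
    (S : set V) (n r : nat) :
  linear f -> has_dim S n -> has_dim (S `&` f @^-1` [set 0]) r ->
  has_dim (f @` S) (n - r).
Proof.
move=> flin dS dU; have [c [fc cS]] := dS.
have f0 : f 0 = 0 by move: (flin (-1) 0 0); rewrite scaler0 addr0 scaleN1r addNr.
have fD u v : f (u + v) = f u + f v by rewrite -[u]scale1r flin !scale1r.
have fZ a u : f (a *: u) = a *: f u by rewrite -[LHS]addr0 -[_ *: u]addr0 flin f0 !addr0.
have Sc : S = range (lcomb c) by rewrite -cS lspan_range.
have [|M UM] := @subspace_coord_mx _ _ _ _ c (has_dim_subspace dU).
  by move=> x []; rewrite Sc.
have -> : r = \rank M.
  by apply: has_dim_inj dU _; rewrite UM; exact: has_dim_coord.
(* [M] describes the kernel of [f] on [S]. The images of a basis of the complement [M^C] form a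
   basis of the image: independent because [M^C] meets [M] trivially, spanning because together they
   fill the coordinate space. *)
rewrite -mxrank_compl.
have fE v : f (lcomb (fun i => lcomb c (row i (row_base M^C%MS))) v) =
    lcomb (fun i => f (lcomb c (row i (row_base M^C%MS)))) v.
  by rewrite lcomb_map.
exists (fun i => f (lcomb c (row i (row_base M^C%MS)))); split.
  apply/lin_indepP => v; rewrite -fE -lcomb_mul => fv0.
  have : (v *m row_base M^C%MS <= M)%MS.
    by apply/(coord_spaceE _ _ fc); rewrite -UM; split=> //; rewrite Sc; eexists.
  move=> vM; have : (v *m row_base M^C%MS <= M :&: M^C)%MS.
    by rewrite sub_capmx vM (submx_trans (submxMl _ _)) // eq_row_base.
  rewrite capmx_compl submx0 => /eqP v0.
  by apply: (row_free_inj (row_base_free M^C%MS)); rewrite v0 mul0mx.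
rewrite lspan_range; apply/seteqP; split.
  move=> _ [v _ <-]; rewrite -fE -lcomb_mul.
  exists (lcomb c (v *m row_base M^C%MS)) => //.
  by rewrite Sc; eexists.
move=> _ [x Sx <-]; move: Sx; rewrite Sc => -[v _ <-].
have : (v <= M + row_base M^C)%MS.
  by rewrite (adds_eqmx (eqmx_refl M) (eq_row_base _)) submx_full // addsmx_compl_full.
move=> /sub_addsmxP [[u w] /= ->]; rewrite lcombD fD.
have [_ ->] : (S `&` f @^-1` [set 0]) (lcomb c (u *m M)).
  by rewrite UM; apply/(coord_spaceE _ _ fc); exact: submxMl.
by exists w => //; rewrite -fE add0r -lcomb_mul.
Qed.

Lemma quot_dimE (K : fieldType) (V : lmodType K) (U S : set V) (n r : nat) :
  U `<=` S -> has_dim U r -> has_dim S n -> quot_dim S U = (n - r)%N.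
Proof.
move=> US dU dS; have subU := has_dim_subspace dU.
have qlin : linear (quot_map U) by move=> a u v; rewrite quot_mapD quot_mapZ.
have q0 : quot_map U 0 = 0.
  by apply: (addrI (quot_map U 0)); rewrite -quot_mapD !addr0.
apply: sdimE; apply: has_dim_image => //.
suff -> : S `&` quot_map U @^-1` [set 0] = U by [].
apply/seteqP; split=> [x [_ /=]|x Ux]; last split; first 1 last.
- exact: US.
- by rewrite /= -q0; apply/quot_map_eq; rewrite subr0 lspan_id.
- by rewrite -q0 => /quot_map_eq; rewrite subr0 lspan_id.
Qed.

(** * Rado's theorem on independent transversals, for families of subspaces *)

Lemma rado_subspaces (F : fieldType) (m n : nat) (W : 'I_m -> 'M[F]_n) :
    (forall J : {set 'I_m}, #|J| <= \rank (\sum_(i in J) W i)%MS)%N ->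
  exists2 P : 'M[F]_(m, n), row_free P & forall i, (row i P <= W i)%MS.
Proof.
(* Induction on the total dimension of the family: as long as some [W k] is more than a line, it is
   replaced by a proper subspace that keeps the rank condition. *)
have [N] := ubnP (\sum_i \rank (W i))%N.
elim: N W => // N IH W /ltnSE leN hall.
have [/existsP [k rk2]|] := boolP [exists k, (1 < \rank (W k))%N]; last first.
  rewrite negb_exists => /forallP rk1.
  (* Every [W i] has rank at most 1, and the condition for singletons makes it a line spanned by its
     nonzero row. The condition for the full index set then says that these rows are independent. *)
  pose P := \matrix_i nz_row (W i).
  have rowP i : row i P = nz_row (W i) by rewrite rowK.
  have WP i : (W i <= P)%MS.
    apply: (submx_trans _ (row_sub i P)); rewrite rowP.
    have := hall [set i]%SET; rewrite cards1 big_set1 => r1.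
    have := rk1 i; rewrite -leqNgt => r1'.
    have := mxrank_leqif_sup (nz_row_sub (W i)) => /leqifP.
    case: ifP => // _; rewrite rank_rV nz_row_eq0.
    by move: r1; rewrite lt0n mxrank_eq0 => -> /= /leq_trans/(_ r1').
  exists P => [|i]; last by rewrite rowP nz_row_sub.
  rewrite -row_leq_rank; have := hall [set: 'I_m]%SET; rewrite cardsT card_ord.
  by move=> /leq_trans; apply; apply/mxrankS/sumsmx_subP => i _.
(* If neither of the proper subspaces H1, H2 with sum W k can replace W k, adding
   up the two violated rank conditions contradicts submodularity of the rank. *)
pose H1 := <<nz_row (W k)>>%MS; pose H2 := (W k :\: H1)%MS.
have nzk : nz_row (W k) != 0.
  by rewrite nz_row_eq0 -mxrank_eq0 -lt0n; apply: ltnW.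
have rH1 : \rank H1 = 1%N by rewrite mxrank_gen rank_rV nzk.
have sH1 : (H1 <= W k)%MS by rewrite genmxE nz_row_sub.
have sH2 : (H2 <= W k)%MS by exact: diffmxSl.
have rH : (\rank H1 + \rank H2 = \rank (W k))%N.
  rewrite -(mxrank_cap_compl (W k) H1) addnC [X in _ = X]addnC; congr addn.
  by rewrite (eqmxP (_ : (W k :&: H1 == H1)%MS)) //; apply/andP; split;
    rewrite ?capmxSr // sub_capmx sH1 submx_refl.
have sH12 : (W k <= H1 + H2)%MS.
  rewrite -(addsmx_diff_cap_eq (W k) H1) addsmxC addsmxS //.
  exact: capmxSr.
pose W' H i := if i == k then H else W i.
(* Either the family with [H] in place of [W k] keeps the rank condition and induction applies, or
   some set violates it. That set contains [k], since the other spaces are unchanged; [J] is what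
   remains after removing [k]. *)
have shrink (H : 'M[F]_n) : (\rank H < \rank (W k))%N -> (H <= W k)%MS ->
    (exists2 P : 'M[F]_(m, n), row_free P & forall i, (row i P <= W i)%MS) \/
    exists2 J : {set 'I_m}, k \notin J &
      (\rank (H + \sum_(i in J) W i)%MS <= #|J|)%N.
  move=> ltH sH.
  have [/forallP hall'|] := boolP [forall J : {set 'I_m},
      (#|J| <= \rank (\sum_(i in J) W' H i)%MS)%N].
    left; have [] := IH (W' H); first 2 last.
    - move=> P freeP PW; exists P => // i; apply: submx_trans (PW i) _.
      by rewrite /W'; case: eqP => // ->.
    - apply: leq_trans leN; rewrite (bigD1 k) //= [X in (_ < X)%N](bigD1 k) //=.
      rewrite /W' eqxx -addSn leq_add //; apply: leq_sum => i /negPf -> //.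
    - exact: hall'.
  rewrite negb_forall => /existsP [J]; rewrite -ltnNge => ltJ; right.
  have notk (I : {set 'I_m}) : k \notin I ->
      (\sum_(i in I) W' H i)%MS = (\sum_(i in I) W i)%MS.
    move=> kI; apply: eq_bigr => i iI; rewrite /W'; case: eqP => // ik.
    by rewrite -ik iI in kI.
  have [kJ|kJ] := boolP (k \in J); last first.
    by move: ltJ; rewrite notk // ltnNge hall.
  exists (J :\ k)%SET; first by rewrite !inE eqxx.
  move: ltJ; rewrite (big_setD1 k) //= {1}/W' eqxx notk ?inE ?eqxx //.
  by rewrite (cardsD1 k J) kJ add1n ltnS.
have [||//|[J1 kJ1 rJ1]] := shrink H1; [lia|by []|].
have [||//|[J2 kJ2 rJ2]] := shrink H2; [lia|by []|].
(* As [k] lies in neither set, the two lower bounds add up to [#|J1| + #|J2| + 1], whereas the ranks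
   of [X1] and [X2] add up to at most [#|J1| + #|J2|]. *)
have h1 := hall (k |: (J1 :|: J2))%SET.
have h2 := hall (J1 :&: J2)%SET.
move: h1; rewrite cardsU1 inE negb_or kJ1 kJ2 /= => h1.
pose X1 := (H1 + \sum_(i in J1) W i)%MS; pose X2 := (H2 + \sum_(i in J2) W i)%MS.
rewrite -/X1 in rJ1; rewrite -/X2 in rJ2.
have s1 : (\sum_(i in (k |: (J1 :|: J2))%SET) W i <= X1 + X2)%MS.
  apply/sumsmx_subP => i; rewrite !inE => /or3P [/eqP ->|iJ|iJ].
  - apply: submx_trans sH12 _; apply: addsmxS; exact: addsmxSl.
  - apply: submx_trans (addsmxSl _ _); apply: submx_trans (addsmxSr _ _).
    exact: (sumsmx_sup i).
  - apply: submx_trans (addsmxSr _ _); apply: submx_trans (addsmxSr _ _).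
    exact: (sumsmx_sup i).
have s2 : (\sum_(i in (J1 :&: J2)%SET) W i <= X1 :&: X2)%MS.
  apply/sumsmx_subP => i; rewrite inE => /andP [i1 i2]; rewrite sub_capmx.
  by apply/andP; split; apply: submx_trans (addsmxSr _ _); exact: (sumsmx_sup i).
have l1 : (#|J1 :|: J2| < \rank (X1 + X2)%MS)%N := leq_trans h1 (mxrankS s1).
have l2 : (#|J1 :&: J2| <= \rank (X1 :&: X2)%MS)%N := leq_trans h2 (mxrankS s2).
have := leq_add l1 l2; rewrite mxrank_sum_cap addSn cardsUI => lt12.
by have := leq_trans lt12 (leq_add rJ1 rJ2); rewrite ltnn.
Qed.

(** * Change of basis, adapted bases and vanishing coordinates *)

Section Bases.
Variables (K : fieldType) (V : lmodType K).

Lemma has_dim_ltn (S T : set V) m n x :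
  S `<=` T -> has_dim S m -> has_dim T n -> T x -> ~ S x -> (m < n)%N.
Proof.
move=> ST dS dT Tx Sx; have subT := has_dim_subspace dT.
apply: has_dim_leq (has_dim_sum_line dS Sx) dT.
move=> _ [y Sy [_ [a _ <-] <-]]; apply: subspaceD => //; first exact: ST.
exact: subspaceZ.
Qed.

Lemma is_basis_unitmx (S : set V) n (c : 'I_n -> V) (P : 'M_n) :
  P \in unitmx -> is_basis S c -> is_basis S (fun i => lcomb c (row i P)).
Proof.
move=> uP [fc <-]; split.
  apply/lin_indepP => v; rewrite -lcomb_mul => /(proj1 (lin_indepP _) fc) vP0.
  by rewrite -[v](mulmxK uP) vP0 mul0mx.
rewrite !lspan_range; apply/seteqP; split=> _ [v _ <-].
  by exists (v *m P); rewrite ?lcomb_mul.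
by exists (v *m invmx P); rewrite // -lcomb_mul mulmxKV.
Qed.

(** A relation in the subfamily is pushed forward along [f] by summing coefficients over fibres,
    which are singletons or empty. *)
Lemma lin_indep_comp m n (b : 'I_n -> V) (f : 'I_m -> 'I_n) :
  injective f -> lin_indep b -> lin_indep (fun i => b (f i)).
Proof.
move=> fI fb k k0 i.
have sum0 : \sum_j (\sum_(l | f l == j) k l) *: b j = 0.
  rewrite -[RHS]k0 [RHS](partition_big f predT) //=; apply: eq_bigr => j _.
  by rewrite scaler_suml; apply: eq_bigr => l /eqP ->.
rewrite -[RHS](fb _ sum0 (f i)) (big_pred1 i) // => l /=.
by rewrite (inj_eq fI).
Qed.

(** Turns the matching condition at index [i] into the vanishing of the [i]-th coordinate. *)
Lemma lspan_coord0 n (b : 'I_n -> V) i v : lin_indep b ->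
  lspan (b @` [set j | j <> i]) (lcomb b v) <-> v 0 i = 0.
Proof.
move=> fb; split=> [sv|vi0].
  have [w /= wi /(lcomb_inj fb) <- //] :
      (lcomb b @` [set w : 'rV[K]_n | w 0 i = 0]) (lcomb b v).
  move: sv; apply: lspan_sub => [|_ [j /= ji <-]].
    apply/subspaceP; split; first by exists 0; rewrite ?lcomb0 //= mxE.
    move=> a _ _ [x /= x0 <-] [y /= y0 <-].
    by exists (a *: x + y); rewrite ?lcombP //= !mxE x0 y0 mulr0 addr0.
  exists (delta_mx 0 j); rewrite ?lcomb_delta //= mxE eqxx /=.
  by case: eqP => // ij; case: ji.
have subl := subspace_lspan (b @` [set j | j <> i]).
apply: (subspace_sum subl) => j; have [->|/eqP ji] := eqVneq j i.
  by rewrite vi0 scale0r; case/subspaceP: subl.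
by apply: (subspaceZ _ subl); apply: sub_lspan; exists j.
Qed.

Lemma extend_basis (S T : set V) n : has_dim T n -> subspace S -> S `<=` T ->
  exists s (a : 'I_n -> V),
    [/\ has_dim S s, (s <= n)%N, is_basis T a & forall i : 'I_n, (i < s)%N -> S (a i)].
Proof.
move=> [c cT] subS ST; have [fc cE] := cT.
have [|M SM] := subspace_coord_mx (c := c) subS; first by rewrite -lspan_range cE.
exists (\rank M), (fun i => lcomb c (row i (row_ebase M))); split.
- by rewrite SM; exact: has_dim_coord.
- exact: rank_leq_row.
- exact: is_basis_unitmx (row_ebase_unit M) cT.
move=> i ltis; rewrite SM; exists (row i (row_ebase M)) => //=.
(* In the factorization of [M] as [col_ebase M], [pid_mx (\rank M)], [row_ebase M], the middle
   factor keeps the first [\rank M] rows of [row_ebase M]; these are therefore rows of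
   [invmx (col_ebase M) *m M]. *)
have -> : row i (row_ebase M) = row i (invmx (col_ebase M) *m M).
  rewrite -{3}(mulmx_ebase M) -mulmxA mulKmx ?col_ebase_unit // row_mul.
  suff -> : row i (pid_mx (\rank M) : 'M[K]_n) = row i 1%:M by rewrite -row_mul mul1mx.
  by apply/rowP => j; rewrite !mxE ltis andbT.
by rewrite (submx_trans (row_sub _ _)) ?submxMl.
Qed.

End Bases.

(** * Products of subspaces in a field extension: the transform, then necessity and sufficiency of
    the dimension condition *)

Section FieldAlgebra.
Variables (K : fieldType) (L : fieldAlgType K).
Implicit Types A B S R : set L.

Lemma has_dim_scale (x : L) S n :
  x != 0 -> has_dim S n -> has_dim [set x * y | y in S] n.
Proof.
move=> x0 dS; have subS := has_dim_subspace dS.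
rewrite -[n]subn0; apply: has_dim_image dS _.
  by move=> a u v; rewrite mulrDr scalerAr.
suff -> : S `&` *%R x @^-1` [set 0] = [set 0] by exact: has_dim_set0.
apply/seteqP; split=> [y [_ /= /eqP]|_ ->].
  by rewrite mulf_eq0 (negPf x0) => /eqP.
by split; rewrite /= ?mulr0 //; case/subspaceP: subS.
Qed.

(** Induction on the codimension [n - s] of [S] in [A]. The sum of dimensions is preserved because
    dividing the intersection of [S] and [x R] by [x] keeps its dimension. *)
Lemma dyson_transform A S R n s r :
  has_dim A n -> has_dim S s -> has_dim R r -> S `<=` A -> R 1 ->
  (forall x y, S x -> R y -> A (x * y)) ->
  exists S' R' s' r', [/\ has_dim S' s', has_dim R' r', (s' + r' = s + r)%N,
      S `<=` S' & S' `<=` A] /\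
    [/\ R' `<=` R, R' 1 & forall x y, S' x -> R' y -> S' (x * y)].
Proof.
move=> dA; have subA := has_dim_subspace dA.
have [N] := ubnP (n - s)%N; elim: N S R s r => // N IH S R s r /ltnSE leN.
move=> dS dR SA R1 SRA; have subS := has_dim_subspace dS.
have [closed|] := pselect (forall x y, S x -> R y -> S (x * y)).
  by exists S, R, s, r; do !split.
move=> /existsNP [x /existsNP [y /not_implyP [Sx /not_implyP [Ry nSxy]]]].
have x0 : x != 0.
  apply: contra_notN nSxy => /eqP ->; rewrite mul0r.
  by case/subspaceP: subS.
pose xR : set L := [set x * z | z in R].
have dxR : has_dim xR r by exact: has_dim_scale.
have xRA : xR `<=` A by move=> _ [z Rz <-]; exact: SRA.
have [p [q [dp dq pq]]] := has_dim_sum_cap dA subS (has_dim_subspace dxR) SA xRA dS dxR.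
pose R1' : set L := [set x^-1 * z | z in S `&` xR].
have R1'P z : R1' z -> S (x * z) /\ R z.
  by move=> [u [Su [w Rw xw]] <-]; rewrite -xw in Su *; rewrite mulKf.
have SS1 : S `<=` sumset S xR.
  move=> z Sz; exists z => //; exists 0; rewrite ?addr0 //.
  by case/subspaceP: (has_dim_subspace dxR).
have S1A : sumset S xR `<=` A.
  by move=> _ [u Su [v xRv <-]]; apply: subspaceD => //; [exact: SA|exact: xRA].
(* The product [x * y] lies in the new left factor but not in [S], so the induction measure
   drops. *)
have ltsp : (s < p)%N.
  apply: (has_dim_ltn SS1 dS dp _ nSxy); exists 0.
    by case/subspaceP: subS.
  by exists (x * y); rewrite ?add0r //; exists y.
have lepn := has_dim_leq S1A dp dA.
have [||||S' [R' [s' [r' [[dS' dR' e S1S' S'A] [R'R1 R'1 cl]]]]]] :=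
    IH (sumset S xR) R1' p q _ dp _ S1A.
- by lia.
- by apply: has_dim_scale => //; rewrite invr_eq0.
- by exists x; rewrite ?mulVf //; split=> //; exists 1; rewrite ?mulr1.
(* For [w] in [R] and [z] in the new right factor, [x * w * z = (x * z) * w], with [x * z] in [S]
   and [w] in [R]. *)
- move=> _ z [u Su [_ [w Rw <-] <-]] /R1'P [Sxz Rz]; rewrite mulrDl.
  apply: subspaceD => //; first exact: SRA.
  by rewrite mulrAC; exact: SRA.
exists S', R', s', r'; split; split=> //; first by rewrite e pq.
  by apply: subset_trans S1S'.
by move=> z /R'R1 /R1'P [].
Qed.

Lemma has_dim_add_scalars B n : has_dim B n -> ~ B 1 -> has_dim (add_scalars B) n.+1.
Proof. exact: has_dim_sum_line. Qed.

Lemma matched_dim_bound A B n S R :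
  has_dim A n -> has_dim B n -> matched A B ->
  subspace S -> subspace R -> S `<=` A -> lspan (mul_set S R) = S ->
  (sdim S <= quot_dim B (R `&` B))%N.
Proof.
move=> dA dB AB subS subR SA SR.
have [s [a [dS les aA Sa]]] := extend_basis dA subS SA.
have [b [fb bB] ab] := AB n a aA.
have subRB : subspace (R `&` B) := subspaceI subR (has_dim_subspace dB).
have [|N RBN] := subspace_coord_mx (c := b) subRB.
  by rewrite -lspan_range bB; exact: subIsetr.
have dRB : has_dim (R `&` B) (\rank N) by rewrite RBN; exact: has_dim_coord.
rewrite (sdimE dS) (@quot_dimE _ _ _ _ n (\rank N)) //.
(* The claim is that the first [s] columns of [N], the coordinates of the elements of [R] and [B] in
   common, vanish; this bounds its rank by [n - s]. *)
suff /mulmx0_rank_max : N *m (pid_mx s : 'M_n) = 0 by rewrite rank_pid_mx //; lia.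
have a0 i : a i != 0 := lin_indep_neq0 i aA.1.
apply/row_matrixP => k; rewrite row0 row_mul; apply/rowP => j; rewrite !mxE.
apply: big1 => i _; rewrite [pid_mx _ _ _]mxE.
have [lti|] := ltnP i s; last by rewrite andbF mulr0.
suff -> : row k N 0 i = 0 by rewrite mul0r.
(* An element [y] of both [R] and [B] satisfies [a i * y] in [S], hence in [A], so the matching
   condition applies to it. *)
apply/(lspan_coord0 i _ fb); apply: ab.
have [Rx Bx] : (R `&` B) (lcomb b (row k N)).
  by rewrite RBN; exists (row k N); rewrite //= row_sub.
split=> //; exists (a i * lcomb b (row k N)); last by rewrite mulKf.
apply: SA; rewrite -SR; apply: sub_lspan; exists (a i); first exact: Sa.
by exists (lcomb b (row k N)).
Qed.

Lemma dim_bound_product A B n S T s t :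
  has_dim A n -> has_dim B n -> ~ B 1 ->
  (forall S R : set L, subspace S -> subspace R ->
     S <> [set 0] -> R <> [set 0] ->
     S `<=` A -> R `<=` add_scalars B -> lspan (mul_set S R) = S ->
     (sdim S <= quot_dim B (R `&` B))%N) ->
  has_dim S s -> has_dim T t -> (0 < s)%N -> S `<=` A -> T `<=` B ->
  (forall x y, S x -> T y -> A (x * y)) -> (s + t <= n)%N.
Proof.
move=> dA dB B1 bound dS dT s0 SA TB STA.
have subA := has_dim_subspace dA; have subB := has_dim_subspace dB.
have T1 : ~ T 1 by move=> /TB.
have R1 : add_scalars T 1.
  exists 0; first by case/subspaceP: (has_dim_subspace dT).
  by exists 1; rewrite ?add0r //; exists 1; rewrite ?scale1r.
have SRA x y : S x -> add_scalars T y -> A (x * y).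
  move=> Sx [z Tz [_ [k _ <-] <-]]; rewrite mulrDr -scalerAr mulr1.
  by apply: subspaceD; [|exact: STA|apply: subspaceZ; [|exact: SA]].
have [S' [R' [s' [r' [[dS' dR' e SS' S'A] [R'R R'1 cl]]]]]] :=
  dyson_transform dA dS (has_dim_add_scalars dT T1) SA R1 SRA.
have subR' := has_dim_subspace dR'.
have R'B : R' `<=` add_scalars B.
  by move=> y /R'R [z Tz zk]; exists z; first exact: TB.
have [q leq dq] := subspace_has_dim (subspaceI subR' subB) (@subIsetr _ R' B) dB.
have R'E : R' = add_scalars (R' `&` B).
  apply/seteqP; split=> [y R'y|_ [z [R'z _] [_ [k _ <-] <-]]].
    have [z Bz [_ [k _ <-] zk]] := R'B y R'y; exists z.
      split=> //; have -> : z = (- k) *: 1 + y by rewrite -zk scaleNr addrC addrK.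
      by apply: subspaceD => //; exact: subspaceZ.
    by exists (k *: 1) => //; exists k.
  by apply: subspaceD => //; exact: subspaceZ.
(* The scalars contribute 1 to the dimensions of both [add_scalars T] and [R'], so [s' + q = s + t]
   and the bound on [S'] is the one wanted. *)
have r'q : r' = q.+1.
  apply: has_dim_inj dR' _; rewrite R'E.
  by apply: has_dim_add_scalars => // -[].
have := bound S' R' (has_dim_subspace dS') subR'.
rewrite (sdimE dS') (@quot_dimE _ _ _ _ n q) //.
have les := has_dim_leq SS' dS dS'.
move=> h; suff : (s' <= n - q)%N by lia.
apply: h => //.
- by move=> S'0; have := has_dim_set0 L; rewrite -S'0 => /(has_dim_inj dS'); lia.
- by move=> R'0; move: R'1; rewrite R'0 => /eqP; rewrite oner_eq0.
apply/seteqP; split.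
  apply: lspan_sub; first exact: has_dim_subspace dS'.
  by move=> _ [x S'x [y R'y <-]]; exact: cl.
move=> x S'x; apply: sub_lspan; exists x => //; by exists 1; rewrite ?mulr1.
Qed.

Lemma matched_of_product_bound A B n :
  has_dim A n -> has_dim B n ->
  (forall S T s t, has_dim S s -> has_dim T t -> (0 < s)%N ->
     S `<=` A -> T `<=` B -> (forall x y, S x -> T y -> A (x * y)) ->
     (s + t <= n)%N) ->
  matched A B.
Proof.
move=> dA [c cB] bound m a aA; have [fc cE] := cB; have [fa aE] := aA.
have dAm : has_dim A m by exists a.
have mn := has_dim_inj dAm dA; subst m => {dAm}.
have subA := has_dim_subspace dA.
have a0 i : a i != 0 := lin_indep_neq0 i fa.
have /choice [M ME] i : exists M : 'M_n,
    [set (a i)^-1 * x | x in A] `&` B = coord_space c M.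
  apply: subspace_coord_mx; last by rewrite -lspan_range cE; exact: subIsetr.
  apply: subspaceI; last by rewrite -cE; exact: subspace_lspan.
  by apply: (@has_dim_subspace _ _ _ n); apply: has_dim_scale; rewrite ?invr_eq0.
(* The rows of [(cokermx (M i))^T] span the annihilator of the row space of [M i]. If the rank
   condition fails for [J], let [S] be spanned by the [a i] with [i] in [J] and [T] be the common
   zero space of their annihilators: its dimension [n - \rank X] exceeds [n - #|J|], against the
   product bound. *)
have [J|P freeP PW] := @rado_subspaces K n n (fun i => (cokermx (M i))^T).
  set X := (\sum_(i in J) _)%MS; rewrite leqNgt; apply/negP => ltJ.
  pose S := lspan (range (fun k : 'I_#|J| => a (enum_val k))).
  have dS : has_dim S #|J|.
    eexists; split; last reflexivity.
    exact: lin_indep_comp (@enum_val_inj _ _) fa.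
  have dT := has_dim_coord (kermx X^T) fc.
  have := bound _ _ _ _ dS dT; rewrite mxrank_ker mxrank_tr.
  suff h : (0 < #|J|)%N /\ [/\ S `<=` A, coord_space c (kermx X^T) `<=` B &
      forall x y, S x -> coord_space c (kermx X^T) y -> A (x * y)].
    by case: h => h0 [h1 h2 h3] /(_ h0 h1 h2 h3); have := rank_leq_row X; lia.
  split; first exact: leq_ltn_trans ltJ.
  split.
  - apply: lspan_sub => // _ [k _ <-]; rewrite -aE; apply: sub_lspan.
    by exists (enum_val k).
  - by move=> _ [v _ <-]; rewrite -cE lspan_range; exists v.
  move=> x y Sx Ty; move: x Sx.
  suff : S `<=` [set x | A (x * y)] by [].
  apply: lspan_sub => [|_ [k _ <-] /=].
    apply/subspaceP; split=> [|l u v /= Au Av].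
      by rewrite /= mul0r; case/subspaceP: subA.
    by rewrite mulrDl -scalerAl; apply: subspaceD => //; exact: subspaceZ.
  set i := enum_val k.
  have [] : ([set (a i)^-1 * x | x in A] `&` B) y.
    rewrite ME; case: Ty => v /sub_kermxP vX <-; exists v => //=.
    (* A vector killed by [X^T] is killed by [cokermx (M i)], hence lies in the row space of
       [M i]. *)
    have /submxP [D DX] : ((cokermx (M i))^T <= X)%MS.
      exact: (sumsmx_sup i) (enum_valP k) (submx_refl _).
    by rewrite submxE -[cokermx _]trmxK DX trmx_mul mulmxA vX mul0mx.
  by move=> [z Az <-] _; rewrite mulVKf.
have uP : P^T \in unitmx by rewrite unitmx_tr -row_free_unit.
(* This basis is dual to the rows of [P]: the coordinates of [lcomb c v] in it are [v *m P^T], and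
   the [i]-th is the pairing of [v] with row [i] of [P], which annihilates [M i]. *)
exists (fun i => lcomb c (row i (invmx P^T))).
  by apply: is_basis_unitmx => //; rewrite unitmx_inv.
have bB := is_basis_unitmx (etrans (unitmx_inv _) uP) cB.
move=> i; rewrite ME => _ [v /= vM <-].
rewrite -[v](mulmxK uP) lcomb_mul; apply/(lspan_coord0 _ _ bB.1).
have /submxP [D DP] := PW i.
suff : v *m (row i P)^T = 0.
  move=> /matrixP/(_ 0 0); rewrite !mxE => v0; rewrite -[RHS]v0.
  by apply: eq_bigr => j _; rewrite !mxE.
move: vM; rewrite submxE => /eqP vM0; rewrite DP trmx_mul trmxK mulmxA vM0.
by rewrite mul0mx.
Qed.

End FieldAlgebra.

Unset Implicit Arguments.

Theorem theorem3p1 (K : fieldType) (L : fieldAlgType K)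
    (properL : scalars K L `<` [set: L]) (n : nat) (A B : set L)
    (subA : subspace A) (subB : subspace B)
    (dimA : has_dim A n) (dimB : has_dim B n)
    (n_gt0 : (0 < n)%N) (B1 : ~ B 1) :
  matched A B <->
  (forall S R : set L, subspace S -> subspace R ->
     S <> [set 0] -> R <> [set 0] ->
     S `<=` A -> R `<=` add_scalars B -> lspan (mul_set S R) = S ->
     (sdim S <= quot_dim B (R `&` B))%N).
Proof.
split=> [AB S R subS subR _ _ SA _ SR|bound].
  exact: matched_dim_bound dimA dimB AB subS subR SA SR.
apply: (matched_of_product_bound dimA dimB) => S T s t.
exact: dim_bound_product dimA dimB B1 bound.
Qed.
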